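(* Let $R\subseteq S$ be commutative rings such that $R$ is a module retract of $S$, $S$ is a finitely generated $R$-module, and $S$ is a coherent regular ring. Let $\mathbf x$ be a strong parameter sequence on $R$ with $\ell(\mathbf x)\le 2$. Then $\mathbf x$ is a regular sequence on $R$.
   Context: All rings are commutative with identity. $R$ is a module retract of $S$ if there is an $R$-module homomorphism $\rho:S\to R$ with $\rho(r)=r$ for all $r\in R$. A ring is coherent if every finitely generated ideal is finitely presented; regular if every finitely generated ideal has finite projective dimension. For $x\in R$ let $C(x)$ be the complex $0\to R\to R_x\to 0$ ($R$ in degree $0$, natural localization map); for a finite sequence $\mathbf x=x_1,\dots,x_\ell$ put $C(\mathbf x)=C(x_1)\otimes_R\cdots\otimes_R C(x_\ell)$ and let $H^i_{\mathbf x}(M)$ be the $i$th cohomology of $C(\mathbf x)\otimes_R M$; $\ell(\mathbf x)=\ell$. Let $K(x)$ be $0\to R\xrightarrow{x}R\to 0$ (degrees $1,0$), $K(\mathbf x)=K(x_1)\otimes\cdots\otimes K(x_\ell)$, $H_i(\mathbf x)$ its homology. For $m\ge n$ the chain map $K(\mathbf x^m)\to K(\mathbf x^n)$ ($\mathbf x^m=x_1^m,\dots,x_\ell^m$) is the tensor product of the maps $K(x_i^m)\to K(x_i^n)$ given by multiplication by $x_i^{m-n}$ in degree $1$ and identity in degree $0$. $\mathbf x$ is weakly proregular if for every $n$ there is $m\ge n$ with $H_i(\mathbf x^m)\to H_i(\mathbf x^n)$ zero for all $i\ge1$. $\mathbf x$ is a parameter sequence on $R$ if it is weakly proregular, $(\mathbf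 x)R\neq R$, and $H^{\ell(\mathbf x)}_{\mathbf x}(R)_p\neq0$ for every prime $p\supseteq(\mathbf x)R$ (the empty sequence is a parameter sequence). It is a strong parameter sequence if $x_1,\dots,x_i$ is a parameter sequence for each $i=1,\dots,\ell(\mathbf x)$. A regular sequence on $M$: each $x_i$ is a non-zero-divisor on $M/(x_1,\dots,x_{i-1})M$ and $M\neq(\mathbf x)M$. *)

(* Defs.v *)
From HB Require Import structures.
From mathcomp Require Import all_boot all_order all_algebra.
Set Implicit Arguments. Unset Strict Implicit. Unset Printing Implicit Defensive.
Import Order.TTheory GRing.Theory.
Local Open Scope ring_scope.

Definition in_ideal {R : comNzRingType} (n : nat) (g : 'I_n -> R) (r : R) : Prop :=
  exists c : 'I_n -> R, r = \sum_(i < n) c i * g i.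

Definition in_ideal_seq {R : comNzRingType} (x : seq R) (r : R) : Prop :=
  in_ideal (fun i : 'I_(size x) => nth 0 x i) r.

Definition prime_ideal {R : comNzRingType} (p : R -> Prop) : Prop :=
  [/\ p 0, ~ p 1,
      (forall a b, p a -> p b -> p (a + b)),
      (forall a b, p b -> p (a * b)) &
      (forall a b, p (a * b) -> p a \/ p b)].

Definition fin_presented_ideal {R : comNzRingType} (I : R -> Prop) : Prop :=
  exists (n : nat) (g : 'I_n -> R) (m : nat) (rel : 'I_m -> 'I_n -> R),
    (forall r, I r <-> in_ideal g r) /\
    (forall c : 'I_n -> R,
        \sum_(i < n) c i * g i = 0 <->
        exists d : 'I_m -> R, forall i, c i = \sum_(k < m) d k * rel k i).

Definition coherent (R : comNzRingType) : Prop :=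
  forall (n : nat) (g : 'I_n -> R), fin_presented_ideal (in_ideal g).

Definition projective {R : comNzRingType} (P : lmodType R) : Prop :=
  forall (A B : lmodType R) (s : {linear A -> B}) (h : {linear P -> B}),
    (forall b, exists a, s a = b) ->
    exists k : {linear P -> A}, forall p, s (k p) = h p.

(* The ideal I of R has finite projective dimension: there is an exact
   sequence 0 -> P_n -> ... -> P_1 -> P_0 -> I -> 0 of projective R-modules
   (encoded with P_i = 0 for i > n and the augmentation P_0 -> R with
   image I). *)
Definition finite_proj_dim_ideal {R : comNzRingType} (I : R -> Prop) : Prop :=
  exists (n : nat) (P : nat -> lmodType R)
         (d : forall i, {linear P i.+1 -> P i}) (e : {linear P 0%N -> R^o}),
    [/\ (forall i, projective (P i)),
        (forall i, (n < i)%N -> forall p : P i, p = 0),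
        (forall r : R, I r <-> exists p, e p = r),
        (forall p, e p = 0 <-> exists q, d 0%N q = p) &
        (forall i (p : P i.+1), d i p = 0 <-> exists q, d i.+1 q = p)].

Definition regular_ring (R : comNzRingType) : Prop :=
  forall (n : nat) (g : 'I_n -> R), finite_proj_dim_ideal (in_ideal g).

Definition module_retract {R S : comNzRingType} (f : {rmorphism R -> S})
    (rho : S -> R) : Prop :=
  [/\ (forall a b, rho (a + b) = rho a + rho b),
      (forall r a, rho (f r * a) = r * rho a) &
      (forall r, rho (f r) = r)].

Definition fin_gen_module {R S : comNzRingType} (f : {rmorphism R -> S}) : Prop :=
  exists (n : nat) (s : 'I_n -> S),
    forall t : S, exists c : 'I_n -> R, t = \sum_(i < n) f (c i) * s i.

(* Chains of K(y), y = y_0, ..., y_(l-1): the free module with basis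
   e_T = e_{t1} /\ ... /\ e_{tk} (t1 < ... < tk) for T a subset of 'I_l,
   represented by coefficient functions; degree of e_T is #|T|.
   d(e_T) = sum_{j in T} (-1)^{#{k in T, k < j}} y_j e_{T \ j}, i.e. *)
Definition koszul_d {R : comNzRingType} {l : nat} (y : 'I_l -> R)
    (c : {set 'I_l} -> R) : {set 'I_l} -> R :=
  fun T => \sum_(j < l | j \notin T)
             (-1) ^+ #|[set k in T | (k < j)%N]| * y j * c (j |: T).

Definition homogeneous {R : comNzRingType} {l : nat} (i : nat)
    (c : {set 'I_l} -> R) : Prop :=
  forall T : {set 'I_l}, #|T| <> i -> c T = 0.

Definition xpow {R : comNzRingType} (x : seq R) (m : nat) : 'I_(size x) -> R :=
  fun j => nth 0 x j ^+ m.
Arguments xpow {R} x m _.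

(* The map H_i(x^m) -> H_i(x^n) induced by e_T |-> (prod_{j in T} x_j^(m-n)) e_T
   is zero: every i-cycle of K(x^m) maps to an i-boundary of K(x^n). *)
Definition koszul_map_zero {R : comNzRingType} (x : seq R) (m n i : nat) : Prop :=
  forall c : {set 'I_(size x)} -> R,
    homogeneous i c ->
    (forall T, koszul_d (xpow x m) c T = 0) ->
    exists b : {set 'I_(size x)} -> R,
      homogeneous i.+1 b /\
      forall T, koszul_d (xpow x n) b T
                = (\prod_(j in T) nth 0 x j ^+ (m - n)) * c T.

Definition weakly_proregular {R : comNzRingType} (x : seq R) : Prop :=
  forall n : nat, exists m : nat,
    (n <= m)%N /\ forall i : nat, (1 <= i)%N -> koszul_map_zero x m n i.

(* H^l_x(R) = R_y / sum_i im(R_{y_i}), y = x_0 ... x_(l-1),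
   y_i = prod_{j <> i} x_j.  Every element of R_y is a / y^k, every element
   of the image is sum_i c_i / y_i^K = (sum_i c_i x_i^K) / y^K, and
   a / y^k = b / y^K in R_y iff y^N (a y^K - b y^k) = 0 for some N.
   [cech_top_zero x a k] : the class of a / y^k in H^l_x(R) is zero. *)
Definition cech_top_zero {R : comNzRingType} (x : seq R) (a : R) (k : nat) : Prop :=
  let y := \prod_(r <- x) r in
  exists (K N : nat) (c : 'I_(size x) -> R),
    y ^+ N * (a * y ^+ K - (\sum_(i < size x) c i * nth 0 x i ^+ K) * y ^+ k) = 0.

(* H^l_x(R)_p <> 0: some element z of H^l_x(R) has z/1 <> 0 in the
   localization, i.e. s z <> 0 for all s outside p. *)
Definition cech_top_loc_nonzero {R : comNzRingType} (x : seq R) (p : R -> Prop)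
    : Prop :=
  exists (a : R) (k : nat), forall s : R, ~ p s -> ~ cech_top_zero x (s * a) k.

Definition parameter_seq {R : comNzRingType} (x : seq R) : Prop :=
  x = [::] \/
  [/\ weakly_proregular x,
      ~ in_ideal_seq x 1 &
      forall p : R -> Prop, prime_ideal p ->
        (forall r, r \in x -> p r) -> cech_top_loc_nonzero x p].

Definition strong_parameter_seq {R : comNzRingType} (x : seq R) : Prop :=
  forall i : nat, (1 <= i <= size x)%N -> parameter_seq (take i x).

Definition regular_seq {R : comNzRingType} (x : seq R) : Prop :=
  (forall i : nat, (i < size x)%N ->
     forall r : R, in_ideal_seq (take i x) (nth 0 x i * r) ->
                   in_ideal_seq (take i x) r) /\
  ~ in_ideal_seq x 1.

(* Main.v *)
Require Import Defs.
From HB Require Import structures.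
From mathcomp Require Import all_boot all_order all_algebra.
From mathcomp Require Import ring_quotient generic_quotient fraction.
From mathcomp Require Import boolp classical_sets.
From mathcomp Require Import ring.
Set Implicit Arguments. Unset Strict Implicit. Unset Printing Implicit Defensive.
Import GRing.Theory.
Local Open Scope classical_set_scope.
Local Open Scope ring_scope.

(** For one element x: S is reduced, because at a prime P minimal over an
    annihilator every finitely generated ideal contained in P has a nonzero
    annihilator at P, so that finite resolutions split at P and S_P is a field.
    If x r = 0 with r <> 0, a prime avoiding the powers of r contains x, and
    H^1_x(R) vanishes there.

    For two elements: let y r = x s with r not in xR, let p be a prime minimal
    over (xR : r), and let q be a prime of S lying over p and containing
    n = {t | rho(tS) <= p}.  Then (xS : r) <= n <= q, and, as S is integral over
    R, q is minimal over (xS : r).  Nonvanishing of H^2_{x,y}(R)_p puts (xR : y)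
    and (yR : x) in p, hence (xS : y) and (yS : x) in n <= q: neither x nor y
    divides the other at q.  But x is zero or regular at q (by an Euler
    characteristic count, S is locally a domain), and "depth at most 1" at q
    makes the finite resolution of (x, y)S split down to the ideal itself, which
    is therefore principal at q, generated by x or by y: a contradiction. *)

(** * Prime ideals *)

Section PrimeIdeals.
Variable S : comNzRingType.
Implicit Types (I W q : S -> Prop).

Definition ideal I : Prop :=
  [/\ I 0, forall a b, I a -> I b -> I (a + b) & forall a b, I b -> I (a * b)].

Definition multiplicative W : Prop := W 1 /\ forall a b, W a -> W b -> W (a * b).

Definition disjoint_sets I W : Prop := forall a, I a -> ~ W a.

(** Zorn's lemma is applied to the sets whose union with [A0] is good, so that [A0] itself settles
    the empty chain. *)
Lemma Zorn_from (good : set (set S)) (A0 : set S) :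
  good A0 ->
  (forall F : set (set S), F !=set0 -> (F `<=` good) ->
     total_on F subset -> good (\bigcup_(X in F) X)) ->
  exists A, [/\ good A, (A0 `<=` A)
    & forall B, good B -> (A `<=` B) -> (B `<=` A)].
Proof.
move=> good0 chain.
pose P (X : set S) := good (A0 `|` X).
have [|A [PA maxA]] := @Zorn_bigcup S P.
  move=> F FP totF; have [F0|/set0P/negP/negPn/eqP ->] := pselect (F !=set0); last first.
    by rewrite bigcup_set0 /P setU0.
  rewrite /P.
  have -> : (A0 `|` \bigcup_(X in F) X =
     \bigcup_(X in [set (A0 `|` X) | X in F]) X).
    rewrite bigcup_image; apply/seteqP; split=> a.
      case=> [A0a|[X FX Xa]]; last by exists X => //; right.
      by case: F0 => X FX; exists X => //; left.
    by case=> X FX [A0a|Xa]; [left|right; exists X].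
  apply: chain; first by case: F0 => X FX; exists (A0 `|` X); exists X.
    by move=> _ [X FX <-]; apply: FP.
  move=> _ _ [X FX <-] [Y FY <-].
  by have [XY|YX] := totF _ _ FX FY; [left|right]; apply: setUS.
exists (A0 `|` A); split=> // B goodB sub a Ba.
have [//|nAa] := pselect ((A0 `|` A) a).
have AB : (A `<=` B) by move=> b Ab; apply: sub; right.
have A0B : (A0 `<=` B) by move=> b Ab; apply: sub; left.
case: (maxA B); last by move/setUidPr: A0B; rewrite /P => ->.
by split=> // BA; apply: nAa; right; apply: BA.
Qed.

(** An ideal maximal among those missing [W] is prime: two elements [a], [b] outside it give
    elements [u + t * a] and [v + w * b] of [W], whose product would lie in the ideal if [a * b]
    did. *)
Lemma prime_disjoint I W :
  ideal I -> multiplicative W -> disjoint_sets I W ->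
  exists q, [/\ prime_ideal q, forall a, I a -> q a & disjoint_sets q W].
Proof.
move=> idI [W1 WM] IW.
have [|F [X0 FX0] Fgood totF|q [[[q0 qD qM] qW] Iq maxq]] :=
  @Zorn_from [set A | ideal A /\ disjoint_sets A W]%classic I.
- by split.
- split; last by move=> a [X FX Xa]; case: (Fgood _ FX) => _; apply.
  split; first by exists X0 => //; case: (Fgood _ FX0) => -[].
    move=> a b [X FX Xa] [Y FY Yb].
    have [XY|YX] := totF _ _ FX FY.
      exists Y => //; case: (Fgood _ FY) => -[_ D _] _.
      by apply: D => //; apply: XY.
    exists X => //; case: (Fgood _ FX) => -[_ D _] _.
    by apply: D => //; apply: YX.
  move=> a b [X FX Xb]; exists X => //.
  by case: (Fgood _ FX) => -[_ _ M] _; apply: M.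
exists q; split=> //; split=> //; first by move=> q1; apply: (qW 1).
move=> a b qab; apply: contrapT => /not_orP [nqa nqb].
have ext c : ~ q c -> exists2 u, q u & exists t, W (u + t * c).
  move=> nqc; apply: contrapT => nex; apply: nqc.
  pose B d := exists2 u, q u & exists t, d = u + t * c.
  apply: (maxq B); last 1 first.
  - by exists 0 => //; exists 1; ring.
  - split; last first.
      move=> _ [u qu [t ->]] Wd; apply: nex; exists u => //; by exists t.
    split; first by exists 0 => //; exists 0; ring.
      move=> _ _ [u qu [t ->]] [u' qu' [t' ->]].
      by exists (u + u'); [apply: qD|exists (t + t'); ring].
    move=> d _ [u qu [t ->]].
    by exists (d * u); [exact: qM|exists (d * t); ring].
  - by move=> d qd; exists d => //; exists 0; ring.
have [u qu [t Wa]] := ext _ nqa; have [v qv [w Wb]] := ext _ nqb.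
apply: (qW _ _ (WM _ _ Wa Wb)).
have -> : (u + t * a) * (v + w * b) = (v + w * b) * u + t * a * v + t * w * (a * b).
  by ring.
by apply: (qD); [apply: (qD)|]; apply: (qM).
Qed.

(* Minimality of q among the primes over I, expressed elementwise in S_q. *)
Definition minimal_over q I : Prop :=
  (forall a, I a -> q a) /\
  forall c, q c -> exists k s, ~ q s /\ I (s * c ^+ k).

Lemma prime_compl q : prime_ideal q -> multiplicative (fun s => ~ q s).
Proof. by case=> _ q1 _ _ qP; split=> // a b na nb /qP []. Qed.

(** Zorn is run on multiplicative sets: a maximal one missing [I] is the complement of a prime
    minimal over [I]. *)
Lemma minimal_prime I W :
  ideal I -> multiplicative W -> disjoint_sets I W ->
  exists q, [/\ prime_ideal q, minimal_over q I & disjoint_sets q W].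
Proof.
move=> idI mW IW.
have [|F [X0 FX0] Fgood totF|M [[[M1 MM] IM] WM maxM]] :=
  @Zorn_from [set A | multiplicative A /\ disjoint_sets I A]%classic W.
- by split.
- split; last by move=> a Ia [X FX Xa]; case: (Fgood _ FX) => _ /(_ a Ia).
  split; first by exists X0 => //; case: (Fgood _ FX0) => -[].
  move=> a b [X FX Xa] [Y FY Yb].
  have [XY|YX] := totF _ _ FX FY.
    exists Y => //; case: (Fgood _ FY) => -[_ D] _.
    by apply: D => //; apply: XY.
  exists X => //; case: (Fgood _ FX) => -[_ D] _.
  by apply: D => //; apply: YX.
have [q [prq Iq qM]] := prime_disjoint idI (conj M1 MM) IM.
have Mcompl a : ~ q a -> M a.
  move=> nqa; apply: (maxM (fun s => ~ q s)) => //.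
    by split; [apply: prime_compl|move=> b Ib; apply; apply: Iq].
  by move=> b Mb qb; apply: (qM b).
exists q; split=> //; last by move=> a qa /WM; apply: qM.
split=> // c qc; apply: contrapT => nex.
(* This multiplicative set contains [c] and the complement of [q]; were it disjoint from [I],
   maximality would put [c] outside [q]. *)
pose B d := exists k s, ~ q s /\ d = s * c ^+ k.
apply: (qM _ qc); apply: (maxM B); last 1 first.
- exists 1%N, 1; split; last by ring.
  by case: prq.
- split; last first.
    by move=> a Ia [k [s [nqs ea]]]; apply: nex; exists k, s; rewrite -ea.
  split; first by exists 0%N, 1; split; [case: prq|ring].
  move=> _ _ [k [s [ns ->]]] [l [t [nt ->]]].
  exists (k + l)%N, (s * t); split; last by rewrite exprD; ring.
  by have [_] := prime_compl prq; apply.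
- move=> a Ma; exists 0%N, a; split; last by ring.
  by move=> qa; apply: (qM a).
Qed.

Lemma prime_exp q a k : prime_ideal q -> q (a ^+ k) -> q a.
Proof.
case=> q0 q1 _ _ qP; elim: k => [|k IH]; first by rewrite expr0 => /q1.
by rewrite exprS => /qP [].
Qed.

End PrimeIdeals.

(** * Residue fields at primes *)

Section ResidueField.
Variables (S : comNzRingType) (q : S -> Prop).

Definition prime_pred (prq : prime_ideal q) : {pred S} := fun a => `[< q a >].

Variable prq : prime_ideal q.

Fact prime_pred_idealr : idealr_closed (prime_pred prq).
Proof.
have [q0 q1 qD qM _] := prq; split; [exact/asboolP|exact/asboolP|].
move=> a b c /asboolP qb /asboolP qc; apply/asboolP.
by apply: (qD) => //; apply: (qM).
Qed.
HB.instance Definition _ := isIdealr.Build S (prime_pred prq) prime_pred_idealr.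

Fact prime_pred_prime : prime_idealr_closed (prime_pred prq).
Proof.
have [_ _ _ _ qP] := prq; move=> a b /asboolP /qP [] h; apply/orP; [left|right]; exact/asboolP.
Qed.
HB.instance Definition _ := isPrimeIdealrClosed.Build S (prime_pred prq) prime_pred_prime.

Definition quot_dom := {ideal_quot (prime_pred prq)}.
HB.instance Definition _ := GRing.ComNzRing.on quot_dom.

Definition quot_unit : pred quot_dom := fun a => `[< exists b, b * a = 1 >].
Definition quot_inv (a : quot_dom) : quot_dom :=
  if pselect (exists b, b * a = 1) is left h then projT1 (cid h) else a.

Fact quot_mulVr : {in quot_unit, left_inverse 1 quot_inv *%R}.
Proof.
move=> a /asboolP h; rewrite /quot_inv; case: pselect => // h'.
by case: cid.
Qed.
Fact quot_unitP : forall a b : quot_dom, b * a = 1 -> quot_unit a.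
Proof. by move=> a b h; apply/asboolP; exists b. Qed.
Fact quot_invr_out : {in [predC quot_unit], quot_inv =1 id}.
Proof.
move=> a /asboolP h; rewrite /quot_inv; by case: pselect.
Qed.
HB.instance Definition _ :=
  GRing.ComNzRing_hasMulInverse.Build quot_dom quot_mulVr quot_unitP quot_invr_out.

Fact quot_dom_axiom : GRing.integral_domain_axiom quot_dom.
Proof. exact: Quotient.rquot_IdomainAxiom. Qed.
HB.instance Definition _ :=
  GRing.ComUnitRing_isIntegral.Build quot_dom quot_dom_axiom.

End ResidueField.

Lemma fractionP (D : idomainType) (z : {fraction D}) :
  exists n d, d != 0 /\ FracField.tofrac d * z = FracField.tofrac n.
Proof.
elim/quotW: z => r; exists \n_r, \d_r; split; first exact: denom_ratioP.
unlock FracField.tofrac; rewrite -[LHS]FracField.pi_mul; apply/eqmodP => /=.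
rewrite FracField.equivfE /FracField.mulf !numden_Ratio ?oner_neq0 ?mul1r ?denom_ratioP //.
by rewrite mulr1 mulrC.
Qed.

(** The field is the fraction field of [S / q]; its second property clears denominators, which lets
    local arguments be carried out in [S]. *)
Lemma residue_field (S : comNzRingType) (q : S -> Prop) : prime_ideal q ->
  exists (k : fieldType) (pi : {rmorphism S -> k}),
    (forall a, pi a = 0 <-> q a) /\
    (forall z, exists a s, ~ q s /\ pi s * z = pi a).
Proof.
move=> prq; pose toq : {rmorphism S -> quot_dom prq} := \pi_(quot_dom prq)%qT.
pose tof : {rmorphism quot_dom prq -> {fraction quot_dom prq}} := @FracField.tofrac _.
have toq0 a : toq a = 0 <-> q a.
  rewrite -(rmorph0 toq).
  split=> [/eqP|qa]; first by rewrite -Quotient.idealrBE subr0 => /asboolP.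
  by apply/eqP; rewrite -Quotient.idealrBE subr0; apply/asboolP.
exists {fraction quot_dom prq}, (tof \o toq); split=> [a|z] /=.
  rewrite -toq0; split=> [/eqP|->]; last exact: rmorph0.
  by rewrite tofrac_eq0 => /eqP.
have [n [d [d0 e]]] := fractionP z.
exists (repr n), (repr d); rewrite /= /toq !reprK; split=> // qd.
by move: d0; rewrite -[d]reprK; move/toq0: qd => /= ->; rewrite eqxx.
Qed.

(** * Finite resolutions and depth *)

Section Matrices.
Variable S : comNzRingType.
Implicit Types (q : S -> Prop).

Definition kills_ker m n p (A : 'M[S]_(m, n)) (E : 'M[S]_(m, p)) : Prop :=
  forall u : 'rV_m, u *m A = 0 -> u *m E = 0.

(* im A (the span of the rows) is projective at q: [E / d] is a projection of
   the free module along ker A. *)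
Definition split_at q m n (A : 'M[S]_(m, n)) : Prop :=
  exists d (E : 'M_m), [/\ ~ q d, E *m A = d *: A & kills_ker A E].

Definition syzygies m n k (A : 'M[S]_(m, n)) (B : 'M[S]_(k, m)) : Prop :=
  forall u : 'rV_m, u *m A = 0 <-> exists w, u = w *m B.

(* im A has a finite resolution by finitely generated free modules, up to a last
   syzygy module im B that is only projective. *)
Inductive fin_res : forall m n, 'M[S]_(m, n) -> Prop :=
| fin_res_proj m n (A : 'M_(m, n)) (E : 'M_m) :
    E *m A = A -> kills_ker A E -> fin_res A
| fin_res_syz m n k (A : 'M_(m, n)) (B : 'M_(k, m)) :
    syzygies A B -> fin_res B -> fin_res A.

Lemma kills_ker_mul m n p l (A : 'M[S]_(m, n)) (E : 'M[S]_(m, p)) (X : 'M_(l, m)) :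
  kills_ker A E -> X *m A = 0 -> X *m E = 0.
Proof.
move=> kE XA; apply/row_matrixP => i; rewrite row0 row_mul kE //.
by rewrite -row_mul XA row0.
Qed.

Lemma syzygies_mul0 m n k (A : 'M[S]_(m, n)) (B : 'M[S]_(k, m)) :
  syzygies A B -> B *m A = 0.
Proof.
move=> AB; apply/row_matrixP => i; rewrite row0 row_mul; apply/AB.
by exists (delta_mx 0 i); rewrite -rowE.
Qed.

Lemma split_idem m n (A : 'M[S]_(m, n)) (E : 'M_m) d :
  E *m A = d *: A -> kills_ker A E -> E *m E = d *: E.
Proof.
move=> EA kE; have : (E - d%:M) *m E = 0.
  by apply: (kills_ker_mul kE); rewrite mulmxBl mul_scalar_mx EA subrr.
by rewrite mulmxBl mul_scalar_mx => /eqP; rewrite subr_eq0 => /eqP.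
Qed.

Section Residue.
Variables (q : S -> Prop) (k : fieldType) (pi : {rmorphism S -> k}).
Hypotheses (prq : prime_ideal q) (pi0 : forall a, pi a = 0 <-> q a).
Hypothesis (piS : forall z, exists a s, ~ q s /\ pi s * z = pi a).

Lemma prime_prod (J : finType) (F : J -> S) : (forall j, ~ q (F j)) -> ~ q (\prod_j F j).
Proof.
by move=> nF; apply: (big_ind (fun s => ~ q s)) => //; have [] := prime_compl prq.
Qed.

Lemma common_denominator m n (Z : 'M[k]_(m, n)) :
  exists s (M : 'M[S]_(m, n)), ~ q s /\ pi s *: Z = map_mx pi M.
Proof.
have /choice [a /choice [s asP]] : forall ij : 'I_m * 'I_n,
    exists a s, ~ q s /\ pi s * Z ij.1 ij.2 = pi a by move=> ij; apply: piS.
exists (\prod_ij s ij), (\matrix_(i, j) (\prod_(ij | ij != (i, j)) s ij * a (i, j))).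
split; first by apply: prime_prod => ij; case: (asP ij).
apply/matrixP => i j; rewrite !mxE (bigD1 (i, j)) //= !rmorphM.
by have [_ /= <-] := asP (i, j); ring.
Qed.

Lemma residue_eq0 m n (M : 'M[S]_(m, n)) :
  map_mx pi M = 0 <-> forall i j, q (M i j).
Proof.
split=> [/matrixP M0 i j|qM]; first by apply/pi0; move: (M0 i j); rewrite !mxE.
by apply/matrixP => i j; rewrite !mxE; apply/pi0.
Qed.

Lemma field_factor m n p (A : 'M[k]_(m, n)) (E : 'M[k]_(m, p)) :
  (forall v : 'rV_m, v *m A = 0 -> v *m E = 0) -> exists D, E = A *m D.
Proof.
move=> kE; exists (pinvmx A *m E).
have : (1%:M - A *m pinvmx A) *m E = 0.
  apply/row_matrixP => i; rewrite row0 row_mul kE // -row_mul.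
  by rewrite mulmxBl mul1mx mulmxKpV ?submx_refl ?subrr ?row0.
by rewrite mulmxBl mul1mx mulmxA => /eqP; rewrite subr_eq0 => /eqP.
Qed.

Lemma rank_idem m (E : 'M[k]_m) : E *m E = E -> \rank (1%:M - E) = (m - \rank E)%N.
Proof.
move=> EE; rewrite -mxrank_ker; apply/eqP; rewrite eqn_leq; apply/andP; split; apply: mxrankS.
  by apply/sub_kermxP; rewrite mulmxBl mul1mx EE subrr.
have /sub_kermxP kE := submx_refl (kermx E).
by apply/submxP; exists (kermx E); rewrite mulmxBr mulmx1 kE subr0.
Qed.

End Residue.

Section Depth.
Variables (q : S -> Prop) (x r : S).
Hypothesis prq : prime_ideal q.
Hypothesis minq : minimal_over q (fun a => exists t, a * r = x * t).
Hypothesis xq : (exists s, ~ q s /\ s * x = 0) \/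
  (forall c, x * c = 0 -> exists s, ~ q s /\ s * c = 0).

(* Any finitely generated ideal inside q multiplies some b into xS with b not in
   xS_q: "depth at most 1" at q. *)
Lemma common_witness (l : seq S) : (forall c, c \in l -> q c) ->
  exists b, [/\ exists u, b = u * r, forall a t, a * b = x * t -> q a &
    forall c, c \in l -> exists t, c * b = x * t].
Proof.
elim: l => [|c l IH] lq.
  exists r; split=> //; first by exists 1; rewrite mul1r.
  by move=> a t e; apply: minq.1; exists t.
have [b [[u bu] bq bl]] : exists b, [/\ exists u, b = u * r, forall a t, a * b = x * t -> q a &
    forall c, c \in l -> exists t, c * b = x * t].
  by apply: IH => d dl; apply: lq; rewrite inE dl orbT.
pose P k := exists s t, ~ q s /\ s * c ^+ k * b = x * t.
have [k0 Pk0] : exists k, P k.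
  have [k [s [ns [t e]]]] := minq.2 c (lq c (mem_head _ _)).
  by exists k, s, (t * u); split=> //; rewrite bu mulrCA e; ring.
have P0 : ~ P 0%N by case=> s [t [ns]]; rewrite expr0 mulr1 => /bq.
have [k [nPk [s [t [ns e]]]]] : exists k, ~ P k /\ P k.+1.
  elim: k0 Pk0 => [//|k IHk Pk]; have [/IHk //|nP] := pselect (P k).
  by exists k.
exists (s * c ^+ k * b); split.
- by exists (s * c ^+ k * u); rewrite bu; ring.
- move=> a t' e'; apply: contrapT => na; apply: nPk; exists (a * s), t'; split.
    by have [_] := prime_compl prq; apply.
  by rewrite -e'; ring.
- move=> d; rewrite inE => /orP [/eqP ->|/bl [t' e']].
    by exists t; rewrite -e exprS; ring.
  by exists (s * c ^+ k * t'); rewrite mulrCA e'; ring.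
Qed.

(** The witness [b] of depth at most 1 gives [b v B = x w]; exactness makes [w] locally of the form
    [v' B]. Then [E] kills [s b v - x v'], so [s b v E] has entries in [xS], and [v E] has entries
    in [q]. *)
Lemma inj_mod_prime m n k (A : 'M[S]_(m, n)) (B : 'M_(k, m)) (E : 'M_k) :
  syzygies A B -> kills_ker B E ->
  forall v : 'rV_k, (forall i j, q ((v *m B) i j)) -> forall i j, q ((v *m E) i j).
Proof.
move=> AB kE v vB; have [_ prM] := prime_compl prq.
have [b [_ bq bl]] : exists b, [/\ exists u, b = u * r, forall a t, a * b = x * t -> q a &
    forall c, c \in [seq (v *m B) 0 j | j : 'I_m] -> exists t, c * b = x * t].
  by apply: common_witness => c /mapP [j _ ->].
have /choice [w0 w0P] : forall j, exists t, (v *m B) 0 j * b = x * t.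
  by move=> j; apply: bl; apply: map_f; rewrite mem_enum.
pose w : 'rV_m := \row_j w0 j.
have bw : b *: (v *m B) = x *: w.
  by apply/rowP => j; rewrite !mxE -w0P !mxE mulrC.
(* If [x] vanishes at [q], [v' = 0] serves; if it is regular there, [x w A = 0] makes [w] a syzygy
   of [A] up to a factor outside [q]. *)
have [s [v' [ns e]]] : exists s (v' : 'rV_k), ~ q s /\ s *: (b *: (v *m B)) = x *: (v' *m B).
  case: xq => [[s [ns sx]]|xnz].
    by exists s, 0; split=> //; rewrite bw scalerA sx mul0mx scaler0 scale0r.
  have xwA : x *: (w *m A) = 0.
    by rewrite scalemxAl -bw -scalemxAl -mulmxA (syzygies_mul0 AB) mulmx0 scaler0.
  have /choice [s sP] : forall j, exists s, ~ q s /\ s * (w *m A) 0 j = 0.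
    by move=> j; apply: xnz; move/rowP: xwA => /(_ j); rewrite !mxE.
  have : (\prod_j s j *: w) *m A = 0.
    rewrite -scalemxAl; apply/rowP => j; rewrite mxE (bigD1 j) //= mulrAC.
    by case: (sP j) => _ ->; rewrite mul0r mxE.
  move/AB => [v' ev']; exists (\prod_j s j), v'; split.
    by apply: (prime_prod prq) => j; case: (sP j).
  by rewrite bw -ev' !scalerA mulrC.
have : ((s * b) *: v - x *: v') *m E = 0.
  by apply: kE; rewrite mulmxBl -!scalemxAl -e scalerA subrr.
rewrite mulmxBl -!scalemxAl => /eqP; rewrite subr_eq0 => /eqP/matrixP vE i j.
apply: contrapT => nvE; apply: (prM _ _ ns nvE); apply: (bq _ ((v' *m E) i j)).
by move: (vE i j); rewrite mxE [RHS]mxE => <-; ring.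
Qed.

(* The matrix [Y] below is congruent modulo q to the scalar [s * d ^+ 2], so
   its determinant avoids q; inverting it splits the inclusion of im B. *)
Lemma split_at_syz m n k (A : 'M[S]_(m, n)) (B : 'M_(k, m)) :
  syzygies A B -> split_at q B -> split_at q A.
Proof.
move=> AB [d [E [nd EB kE]]]; have [n1 prM] := prime_compl prq.
have EE := split_idem EB kE.
have [K [pi [pi0 piS]]] := residue_field prq.
(* By [inj_mod_prime] the kernel of [B] over the residue field lies in that of [E]. *)
have [D0 ED] : exists D, map_mx pi E = map_mx pi B *m D.
  apply: field_factor => v vB.
  have [s [w [ns sv]]] := common_denominator prq piS v.
  have wE : map_mx pi (w *m E) = 0.
    apply/(residue_eq0 pi0)/(inj_mod_prime AB kE)/(residue_eq0 pi0).
    by rewrite map_mxM -sv -scalemxAl vB scaler0.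
  move: wE; rewrite map_mxM -sv -scalemxAl => /eqP.
  by rewrite scaler_eq0 => /orP [/eqP /pi0 //|/eqP].
have [s [D [ns sD]]] := common_denominator prq piS D0.
pose M := B *m D *m E.
pose Y := M + (s * d) *: (d%:M - E).
have EY : E *m Y = d *: M.
  rewrite mulmxDr -scalemxAr mulmxBr EE mul_mx_scalar subrr scaler0 addr0.
  by rewrite /M !mulmxA EB -!scalemxAl.
have piY : map_mx pi Y = (pi (s * d ^+ 2))%:M.
  rewrite map_mxD /M !map_mxM -sD -scalemxAr -ED map_mxZ map_mxB map_scalar_mx.
  rewrite -scalemxAl -map_mxM EE map_mxZ scalerA -rmorphM scalerBr addrC subrK.
  by rewrite scale_scalar_mx -rmorphM; congr (pi _)%:M; ring.
have nY : ~ q (\det Y).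
  move/pi0; rewrite -det_map_mx piY det_scalar => /eqP.
  rewrite expf_eq0 => /andP [_ /eqP /pi0].
  by apply: (prM) => //; rewrite expr2; apply: (prM).
(* [G] retracts the inclusion of im [B] up to the factor [det Y * d], so the complementary
   endomorphism kills im [B], the kernel of [A]. *)
pose G := d *: (D *m E *m \adj Y).
have BG : B *m G = \det Y *: E.
  rewrite -mul_mx_scalar -mul_mx_adj mulmxA EY /M /G.
  by rewrite -scalemxAr -scalemxAl !mulmxA.
exists (\det Y * d), ((\det Y * d)%:M - G *m B); split; first exact: prM.
  by rewrite mulmxBl mul_scalar_mx -mulmxA (syzygies_mul0 AB) mulmx0 subr0.
move=> u /AB [w ->].
rewrite mulmxBr mul_mx_scalar -!mulmxA (mulmxA B) BG -scalemxAl EB scalerA.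
by rewrite -scalemxAr subrr.
Qed.

(** Splitting climbs the resolution from its projective last syzygy module back to im [A]. *)
Lemma fin_res_split_at m n (A : 'M[S]_(m, n)) : fin_res A -> split_at q A.
Proof.
elim=> {m n A} [m n A E EA kE|m n k A B AB _]; last exact: split_at_syz.
by exists 1, E; split; rewrite ?scale1r //; case: (prime_compl prq).
Qed.

End Depth.

End Matrices.

(** * Ranks at generic primes *)

Section Ranks.
Variable S : comNzRingType.
Implicit Types (q : S -> Prop).

(** An invertible square submatrix of maximal size modulo [q] has determinant outside [q], hence
    outside [P]. *)
Lemma rank_specialization q P (k K : fieldType) (pi : {rmorphism S -> k})
    (Pi : {rmorphism S -> K}) m n (M : 'M[S]_(m, n)) :
  (forall a, pi a = 0 <-> q a) -> (forall a, Pi a = 0 <-> P a) ->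
  (forall a, P a -> q a) -> (\rank (map_mx pi M) <= \rank (map_mx Pi M))%N.
Proof.
move=> pi0 Pi0 Pq; set r := \rank _.
pose f := maxrankfun (map_mx pi M).
have full : row_full (rowsub f (map_mx pi M))^T.
  by rewrite /row_full mxrank_tr; have := maxrowsub_free (map_mx pi M).
pose g := fullrankfun full.
have unitq : rowsub g (rowsub f (map_mx pi M))^T \in unitmx := fullrowsub_unit full.
pose N := rowsub g (rowsub f M)^T.
have unitP : map_mx Pi N \in unitmx.
  rewrite unitmxE unitfE det_map_mx; apply/eqP => /Pi0 /Pq /pi0 /eqP.
  apply/negP; rewrite -det_map_mx -unitfE -unitmxE.
  suff -> : map_mx pi N = rowsub g (rowsub f (map_mx pi M))^T by [].
  by apply/matrixP => i j; rewrite !mxE.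
have <- : \rank (map_mx Pi N) = r by exact: mxrank_unit unitP.
have -> : map_mx Pi N = rowsub g (rowsub f (map_mx Pi M))^T.
  by apply/matrixP => i j; rewrite !mxE.
apply: leq_trans (mxrankS (rowsub_sub _ _)) _; rewrite mxrank_tr.
exact: mxrankS (rowsub_sub _ _).
Qed.

(** Rank semicontinuity applies to both [E] and [1 - E], whose ranks add up to [m]. *)
Lemma rank_idem_specialization q P (k K : fieldType) (pi : {rmorphism S -> k})
    (Pi : {rmorphism S -> K}) m (E : 'M[S]_m) :
  (forall a, pi a = 0 <-> q a) -> (forall a, Pi a = 0 <-> P a) ->
  (forall a, P a -> q a) -> E *m E = E ->
  \rank (map_mx Pi E) = \rank (map_mx pi E).
Proof.
move=> pi0 Pi0 Pq EE; apply/eqP; rewrite eqn_leq (rank_specialization E pi0 Pi0) // andbT.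
have := rank_specialization (1%:M - E) pi0 Pi0 Pq.
rewrite !map_mxB !map_mx1 !rank_idem -?map_mxM ?EE //.
by move/(leq_sub2l m); rewrite !subKn ?rank_leq_row.
Qed.

(** For a prime [P] this says that the maximal ideal of the localization at [P] is zero. *)
Definition field_at (P : S -> Prop) : Prop :=
  forall c, P c -> exists s, ~ P s /\ s * c = 0.

Section FieldAt.
Variables (P : S -> Prop) (K : fieldType) (pi : {rmorphism S -> K}).
Hypotheses (prP : prime_ideal P) (pi0 : forall a, pi a = 0 <-> P a).
Hypothesis piS : forall z, exists a s, ~ P s /\ pi s * z = pi a.
Hypothesis fP : field_at P.

(** Clearing denominators leaves [u *m A] with entries in [P]; these are zero at [P], so a further
    factor outside [P] kills them. *)
Lemma lift_ker m n (A : 'M[S]_(m, n)) (v : 'rV[K]_m) : v *m map_mx pi A = 0 ->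
  exists s (u : 'rV_m), [/\ pi s != 0, u *m A = 0 & pi s *: v = map_mx pi u].
Proof.
move=> vA; have [s [u [ns su]]] := common_denominator prP piS v.
have : map_mx pi (u *m A) = 0 by rewrite map_mxM -su -scalemxAl vA scaler0.
move/(residue_eq0 pi0) => uA.
have /choice [t tP] : forall j, exists t, ~ P t /\ t * (u *m A) 0 j = 0.
  by move=> j; apply: fP.
have nt : ~ P (\prod_j t j) by apply: (prime_prod prP) => j; case: (tP j).
exists ((\prod_j t j) * s), (\prod_j t j *: u); split.
- by rewrite rmorphM mulf_neq0 //; apply/eqP => /pi0.
- rewrite -scalemxAl; apply/rowP => j; rewrite mxE (bigD1 j) //= mulrAC.
  by case: (tP j) => _ ->; rewrite mul0r mxE.
- by rewrite rmorphM -scalerA su map_mxZ.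
Qed.

Lemma rank_proj m n (A : 'M[S]_(m, n)) (E : 'M_m) :
  E *m A = A -> kills_ker A E -> \rank (map_mx pi A) = \rank (map_mx pi E).
Proof.
move=> EA kE; apply/eqP; rewrite eqn_leq; apply/andP; split.
  by rewrite -{1}EA map_mxM mxrankM_maxl.
have [|D ->] := @field_factor _ _ _ _ (map_mx pi A) (map_mx pi E); last exact: mxrankM_maxl.
move=> v /lift_ker [s [u [s0 uA su]]].
have /eqP : pi s *: (v *m map_mx pi E) = 0.
  by rewrite scalemxAl su -map_mxM kE ?map_mx0.
by rewrite scaler_eq0 (negPf s0) => /eqP.
Qed.

(** This is rank-nullity: lifting kernel vectors shows that [B] still spans the kernel over [K]. *)
Lemma rank_syz m n k (A : 'M[S]_(m, n)) (B : 'M_(k, m)) : syzygies A B ->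
  \rank (map_mx pi A) = (m - \rank (map_mx pi B))%N.
Proof.
move=> AB; suff -> : \rank (map_mx pi B) = \rank (kermx (map_mx pi A)).
  by rewrite mxrank_ker subKn ?rank_leq_row.
apply/eqP; rewrite eqn_leq; apply/andP; split; apply: mxrankS.
  by apply/sub_kermxP; rewrite -map_mxM (syzygies_mul0 AB) map_mx0.
apply/row_subP => i.
have /lift_ker [s [u [s0 /AB [w ->] su]]] : row i (kermx (map_mx pi A)) *m map_mx pi A = 0.
  by rewrite -row_mul mulmx_ker row0.
by rewrite -(eqmx_scale _ s0) su map_mxM submxMl.
Qed.

End FieldAt.

(** An Euler characteristic argument: the rank of im [A] at either prime is determined by that of
    the last, projective syzygy module, whose idempotent has the same rank at [q], [P1] and [P2]. *)
Lemma fin_res_rank q P1 P2 (K1 K2 : fieldType) (pi1 : {rmorphism S -> K1})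
    (pi2 : {rmorphism S -> K2}) m n (A : 'M[S]_(m, n)) :
  prime_ideal q -> prime_ideal P1 -> prime_ideal P2 ->
  (forall a, P1 a -> q a) -> (forall a, P2 a -> q a) ->
  (forall a, pi1 a = 0 <-> P1 a) -> (forall a, pi2 a = 0 <-> P2 a) ->
  (forall z, exists a s, ~ P1 s /\ pi1 s * z = pi1 a) ->
  (forall z, exists a s, ~ P2 s /\ pi2 s * z = pi2 a) ->
  field_at P1 -> field_at P2 ->
  fin_res A -> \rank (map_mx pi1 A) = \rank (map_mx pi2 A).
Proof.
move=> prq prP1 prP2 P1q P2q pi10 pi20 pi1S pi2S f1 f2.
elim=> {m n A} [m n A E EA kE|m n k A B AB _ IH]; last first.
  by rewrite (rank_syz prP1 pi10 pi1S f1 AB) (rank_syz prP2 pi20 pi2S f2 AB) IH.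
rewrite (rank_proj prP1 pi10 pi1S f1 EA kE) (rank_proj prP2 pi20 pi2S f2 EA kE).
have EE : E *m E = E.
  by rewrite -[RHS]scale1r; apply: (split_idem _ kE); rewrite scale1r.
have [k [pi [pi0 _]]] := residue_field prq.
by rewrite (rank_idem_specialization pi0 pi10 P1q EE)
  (rank_idem_specialization pi0 pi20 P2q EE).
Qed.

Definition fin_res_ideals : Prop := forall n (g : 'cV[S]_n), fin_res g.

Hypothesis resS : fin_res_ideals.

Definition annihilator (b : S) : S -> Prop := fun a => a * b = 0.

Lemma ideal_annihilator b : ideal (annihilator b).
Proof.
rewrite /annihilator; split=> [|a c ea ec|a c ec]; first by rewrite mul0r.
  by rewrite mulrDl ea ec addr0.
by rewrite -mulrA ec mulr0.
Qed.

(** The depth results apply with [x = 0]. The splitting of [cS] at [P] is a scalar [e] with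
    [e c = d c]; a witness [b'] killed by [c] but by nothing outside [P] forces [e] into [P], so
    [d - e] is outside [P] and kills [c]. *)
Lemma field_at_weak_assoc b P :
  prime_ideal P -> minimal_over P (annihilator b) -> field_at P.
Proof.
move=> prP minP c Pc.
have minP' : minimal_over P (fun a => exists t, a * b = 0 * t).
  case: minP => Ib Pmin; split=> [a [t]|d /Pmin [k [s [ns e]]]].
    by rewrite mul0r => /Ib.
  by exists k, s; split=> //; exists 0; rewrite mul0r.
have x0 : (exists s, ~ P s /\ s * 0 = 0 :> S) \/
    (forall d, 0 * d = 0 -> exists s, ~ P s /\ s * d = 0).
  by left; exists 1; split; [case: prP|rewrite mulr0].
have [d [E [nd EA kE]]] := fin_res_split_at prP minP' x0 (resS (c%:M : 'cV_1)).
have [b' [_ b'P /(_ c (mem_head _ _)) [t cb']]] : exists b', [/\ exists u, b' = u * b,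
    forall a t, a * b' = 0 * t -> P a & forall d, d \in [:: c] -> exists t, d * b' = 0 * t].
  by apply: (common_witness prP minP') => ? ; rewrite inE => /eqP ->.
have PE : P (E 0 0).
  apply: (b'P _ 0); rewrite mul0r.
  have /matrixP/(_ 0 0) : (b'%:M : 'rV_1) *m E = 0.
    apply: kE; rewrite mul_scalar_mx scale_scalar_mx mulrC cb' mul0r.
    by apply/matrixP => i j; rewrite !mxE mul0rn.
  by rewrite mul_scalar_mx !mxE mulrC.
exists (d - E 0 0); split.
  move=> Pd; apply: nd; have [_ _ PD _ _] := prP.
  by have := PD _ _ Pd PE; rewrite subrK.
move/matrixP/(_ 0 0): EA; rewrite !mxE big_ord1 !mxE eqxx !mulr1n => e.
by rewrite mulrBl e subrr.
Qed.

(** If [r] is nonzero, take [P] minimal over its annihilator: the nilpotent [r] lies in [P], so it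
    is killed by an element outside [P], a contradiction. *)
Lemma reduced_regular r n : r ^+ n = 0 -> r = 0 :> S.
Proof.
move=> rn; apply: contrapT => r0.
have [|||P [prP minP _]] := @minimal_prime _ (annihilator r) (fun a => a = 1).
- exact: ideal_annihilator.
- by split=> // a b -> ->; rewrite mulr1.
- by move=> a ea a1; apply: r0; rewrite -[r]mul1r -a1.
have [P0 _ _ _ _] := prP.
have [s [ns sr]] : exists s, ~ P s /\ s * r = 0.
  by apply: (field_at_weak_assoc prP minP); apply: (@prime_exp _ _ _ n) => //; rewrite rn.
by apply: ns; apply: minP.1.
Qed.

(* If x c = 0 with x and c both nonzero at q, the rank of the ideal xS, which
   its resolution makes constant below q, would be 0 at a prime minimal over
   ann(c) and 1 at a prime minimal over ann(x). *)
Lemma regular_or_zero_at q x : prime_ideal q ->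
  (exists s, ~ q s /\ s * x = 0) \/
  (forall c, x * c = 0 -> exists s, ~ q s /\ s * c = 0).
Proof.
move=> prq; apply: contrapT => /not_orP [nx /existsNP [c /not_implyP [xc nc]]].
have weak b : ~ (exists s, ~ q s /\ s * b = 0) ->
    exists P, [/\ prime_ideal P, minimal_over P (annihilator b) & forall a, P a -> q a].
  move=> nb.
  have [|||P [prP minP Pq]] := @minimal_prime _ (annihilator b) (fun s => ~ q s).
  - exact: ideal_annihilator.
  - exact: prime_compl.
  - by move=> a ea na; apply: nb; exists a.
  by exists P; split=> // a Pa; apply: contrapT => na; apply: (Pq a).
have [P1 [prP1 min1 P1q]] := weak _ nc.
have [P2 [prP2 min2 P2q]] := weak _ nx.
have f1 := field_at_weak_assoc prP1 min1; have f2 := field_at_weak_assoc prP2 min2.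
have [K1 [pi1 [pi10 pi1S]]] := residue_field prP1.
have [K2 [pi2 [pi20 pi2S]]] := residue_field prP2.
have := fin_res_rank prq prP1 prP2 P1q P2q pi10 pi20 pi1S pi2S f1 f2 (resS (x%:M : 'cV_1)).
rewrite !map_scalar_mx.
have -> : pi1 x = 0 by apply/pi10; apply: min1.1.
have x2 : pi2 x != 0.
  apply/eqP => /pi20 /f2 [s [ns sx]]; apply: ns; exact: min2.1.
by rewrite raddf0 mxrank0 -scalemx1 mxrank_scale_nz // mxrank1.
Qed.

End Ranks.

(** * Finite resolutions over coherent regular rings *)

Section Projective.
Variable R : comNzRingType.

Lemma linear_ex (U V : lmodType R) (g : U -> V) :
  (forall a u v, g (a *: u + v) = a *: g u + g v) -> exists G : {linear U -> V}, G =1 g.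
Proof.
move=> lg; pose G := GRing.isLinear.Build R U V *:%R g lg.
by exists (HB.pack_for {linear U -> V} g G).
Qed.

Section Image.
Variables (A B : lmodType R) (s : {linear A -> B}).

Definition image_pred : {pred B} := fun b => `[< exists a, s a = b >].

Fact image_pred_submod : submod_closed image_pred.
Proof.
split; first by apply/asboolP; exists 0; rewrite linear0.
move=> c _ _ /asboolP [a <-] /asboolP [a' <-]; apply/asboolP.
by exists (c *: a + a'); rewrite linearP.
Qed.
HB.instance Definition _ := GRing.isSubmodClosed.Build R B image_pred image_pred_submod.

Record image_mod := ImageMod { image_val : B; _ : image_val \in image_pred }.
HB.instance Definition _ := [isSub of image_mod for image_val].
HB.instance Definition _ := [Choice of image_mod by <:].
HB.instance Definition _ := [SubChoice_isSubLmodule of image_mod by <:].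
End Image.

(** Projectivity concerns surjections, so both maps are first corestricted to the image of [s]. *)
Lemma projective_lift (P A B : lmodType R) (s : {linear A -> B}) (h : {linear P -> B}) :
  projective P -> (forall p, exists a, s a = h p) ->
  exists k : {linear P -> A}, forall p, s (k p) = h p.
Proof.
move=> prP sh.
have sP a : s a \in image_pred s by apply/asboolP; exists a.
have hP p : h p \in image_pred s by apply/asboolP.
have [s' s'E] : exists s' : {linear A -> image_mod s}, s' =1 fun a => ImageMod (sP a).
  by apply: linear_ex => c u v; apply: val_inj; rewrite /= linearP.
have [h' h'E] : exists h' : {linear P -> image_mod s}, h' =1 fun p => ImageMod (hP p).
  by apply: linear_ex => c u v; apply: val_inj; rewrite /= linearP.
have [|k kP] := prP _ _ s' h'.
  move=> [b bim]; have /asboolP [a ab] := bim.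
  by exists a; rewrite s'E; apply: val_inj.
by exists k => p; have := congr1 val (kP p); rewrite s'E h'E.
Qed.

Lemma projective_pair (P Q : lmodType R) :
  projective P -> projective Q -> projective (P * Q)%type.
Proof.
move=> prP prQ A B s h sB.
have [h1 h1E] : exists h1 : {linear P -> B}, h1 =1 fun p => h (p, 0).
  apply: linear_ex => c u v; rewrite -linearP; congr (h _).
  by apply: injective_projections; rewrite /= ?scaler0 ?addr0.
have [h2 h2E] : exists h2 : {linear Q -> B}, h2 =1 fun p => h (0, p).
  apply: linear_ex => c u v; rewrite -linearP; congr (h _).
  by apply: injective_projections; rewrite /= ?scaler0 ?addr0.
have [k1 k1E] := prP _ _ s h1 sB; have [k2 k2E] := prQ _ _ s h2 sB.
have [k kE] : exists k : {linear (P * Q)%type -> A}, k =1 fun z => k1 z.1 + k2 z.2.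
  by apply: linear_ex => c u v; rewrite /= !linearP scalerDr addrACA.
exists k => -[p q]; rewrite kE linearD k1E k2E h1E h2E -linearD.
by congr (h _); apply: injective_projections; rewrite /= ?addr0 ?add0r.
Qed.

Lemma projective_rV m : projective 'rV[R]_m.
Proof.
move=> A B s h sB; have /choice [a aE] : forall i, exists a, s a = h (delta_mx 0 i).
  by move=> i; apply: sB.
have [k kE] : exists k : {linear 'rV[R]_m -> A}, k =1 fun u => \sum_i u 0 i *: a i.
  apply: linear_ex => c u v; rewrite scaler_sumr -big_split /=.
  by apply: eq_bigr => i _; rewrite !mxE scalerDl scalerA.
exists k => u; rewrite kE linear_sum [in RHS](row_sum_delta u) linear_sum.
by apply: eq_bigr => i _; rewrite !linearZ /= aE.
Qed.

(* The image of e has finite projective dimension. *)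
Inductive fpd : forall P B : lmodType R, {linear P -> B} -> Prop :=
| fpd_inj (P B : lmodType R) (e : {linear P -> B}) :
    projective P -> (forall p, e p = 0 -> p = 0) -> fpd e
| fpd_step (P' P B : lmodType R) (d : {linear P' -> P}) (e : {linear P -> B}) :
    projective P -> (forall p, e p = 0 <-> exists p', d p' = p) -> fpd d -> fpd e.

Lemma finite_proj_dim_fpd (I : R -> Prop) : finite_proj_dim_ideal I ->
  exists (P : lmodType R) (e : {linear P -> R^o}),
    fpd e /\ forall r, I r <-> exists p, e p = r.
Proof.
case=> n [P [d [e [prP P0 imE kerE exP]]]]; exists (P 0%N), e; split=> //.
apply: (fpd_step (d := d 0%N)) => //.
(* For [n <= i] the source [P i.+1] of [d i] is zero, which starts the induction on [n - i]. *)
have fd j : forall i, (n - i <= j)%N -> fpd (d i).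
  elim: j => [|j IH] i.
    by rewrite leqn0 subn_eq0 => ni; apply: fpd_inj => // p _; apply: P0.
  move=> ij; apply: (fpd_step (d := d i.+1)) => //.
  by apply: IH; rewrite subnS; case: (n - i)%N ij.
exact: (fd n 0%N (leq_subr _ _)).
Qed.

Hypothesis kernels_fg : forall m n (A : 'M[R]_(m, n)), exists k (B : 'M_(k, m)), syzygies A B.

(* Schanuel's lemma, in the form of a dimension shift along [fpd]: the auxiliary
   projective summands [Z] and [Q] absorb the stable isomorphisms. *)
Lemma fpd_fin_res (P B : lmodType R) (e : {linear P -> B}) : fpd e ->
  forall (Z Q : lmodType R) m k (A : 'M[R]_(m, k))
    (e' : {linear (P * Z)%type -> ('rV[R]_k * Q)%type}),
  projective Z -> projective Q ->
  (forall p z, e' (p, z) = 0 <-> e p = 0 /\ z = 0) ->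
  (forall v q, (exists y, e' y = (v, q)) <-> exists u, v = u *m A) ->
  fin_res A.
Proof.
have cover (Q : lmodType R) m k (A : 'M[R]_(m, k)) :
    exists s : {linear ('rV[R]_m * Q)%type -> ('rV[R]_k * Q)%type},
      s =1 fun z => (z.1 *m A, z.2).
  apply: linear_ex => c u v; congr (_, _).
  by rewrite /= mulmxDl -scalemxAl.
have lift (P0 Z Q : lmodType R) m k (A : 'M[R]_(m, k))
    (e' : {linear (P0 * Z)%type -> ('rV[R]_k * Q)%type})
    (s : {linear ('rV[R]_m * Q)%type -> ('rV[R]_k * Q)%type}) :
    projective P0 -> projective Z -> s =1 (fun z => (z.1 *m A, z.2)) ->
    (forall v q, (exists y, e' y = (v, q)) <-> exists u, v = u *m A) ->
    exists al : {linear (P0 * Z)%type -> ('rV[R]_m * Q)%type}, forall y, s (al y) = e' y.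
  move=> prP prZ sE imE; apply: projective_lift; first exact: projective_pair.
  move=> y; have [u eu] : exists u, (e' y).1 = u *m A.
    by apply/(imE _ (e' y).2); exists y; case: (e' y).
  by exists (u, (e' y).2); rewrite sE /= -eu; case: (e' y).
elim=> {P B e} [P B e prP inj|P' P B d e prP kerE _ IH] Z Q m k A e' prZ prQ ker' im'.
  have [s sE] := cover Q m k A.
  have [al alE] := lift _ _ _ _ _ _ _ _ prP prZ sE im'.
  (* Here [e'] is injective, so sending the rows of [A] back through [e'] and then along the lift
     [al] gives a projection with kernel that of [A]. *)
  have /choice [y yE] : forall i, exists y, e' y = (row i A, 0).
    by move=> i; apply/im'; exists (delta_mx 0 i); rewrite -rowE.
  apply: (@fin_res_proj _ _ _ A (\matrix_i (al (y i)).1)).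
    apply/row_matrixP => i; rewrite row_mul rowK.
    by have := congr1 fst (alE (y i)); rewrite sE yE.
  move=> u uA.
  have Y0 : \sum_i u 0 i *: y i = 0.
    suff : e' (\sum_i u 0 i *: y i) = 0.
      by case: (\sum_i _) => p z /ker' [/inj -> ->].
    rewrite linear_sum; apply: injective_projections.
      rewrite raddf_sum /= -[RHS]uA mulmx_sum_row; apply: eq_bigr => i _.
      by rewrite linearZ /= yE.
    by rewrite raddf_sum big1 //= => i _; rewrite linearZ /= yE /= scaler0.
  rewrite mulmx_sum_row; have := congr1 (fun z => (al z).1) Y0.
  rewrite linear0 linear_sum raddf_sum /= => al0; rewrite -[RHS]al0.
  by apply: eq_bigr => i _; rewrite rowK linearZ.
have [s sE] := cover Q m k A.
have [al alE] := lift _ _ _ _ _ _ _ _ prP prZ sE im'.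
have [be beE] : exists be : {linear ('rV[R]_m * Q)%type -> (P * Z)%type},
    forall z, e' (be z) = s z.
  apply: projective_lift; first by apply: projective_pair => //; apply: projective_rV.
  by move=> z; rewrite sE; apply/im'; exists z.1.
have e'd p : e' (d p, 0) = 0 by apply/ker'; split=> //; apply/kerE; exists p.
have [K [BK AK]] := kernels_fg A.
(* Schanuel's map sends [w = (p', z)] to [(z - al y, y)] with [y = (d p', 0) + be z]. Its kernel is
   that of [d] and its image is ker [A] plus [P * Z], so the new auxiliary summands are ['rV_m * Q]
   and [P * Z]. *)
pose yy (w : P' * ('rV[R]_m * Q)) : P * Z := (d w.1, 0) + be w.2.
have [e'' e''E] : exists e'' : {linear (P' * ('rV[R]_m * Q))%type -> ('rV[R]_m * (P * Z))%type},
    e'' =1 fun w => ((w.2 - al (yy w)).1, yy w).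
  have yyP c u v : yy (c *: u + v) = c *: yy u + yy v.
    rewrite /yy /= !linearP scalerDr addrACA; congr (_ + _).
    by congr (_, _); rewrite /= scaler0 addr0.
  apply: linear_ex => c u v; rewrite yyP; congr (_, _).
  suff -> : (c *: u + v).2 - al (c *: yy u + yy v) =
      c *: (u.2 - al (yy u)) + (v.2 - al (yy v)) by [].
  by rewrite [al _]linearP opprD addrACA -scalerBr.
have syy w : s (w.2 - al (yy w)) = 0.
  by rewrite linearB alE /yy linearD e'd add0r beE subrr.
apply: (fin_res_syz AK); apply: (IH _ _ _ _ _ e'') => //.
- by apply: projective_pair => //; apply: projective_rV.
- exact: projective_pair.
- move=> p z; rewrite e''E; split; last first.
    case=> dp ->; have -> : yy (p, 0) = 0 by rewrite /yy /= dp linear0 addr0.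
    by rewrite linear0 subr0.
  move=> e0; have y0 : yy (p, z) = 0 by have := congr1 snd e0.
  have z0 : z = 0.
    move: (congr1 fst e0) (syy (p, z)); rewrite y0 linear0 /= !subr0 sE.
    by move=> z1 /(congr1 snd) /= z2; apply: injective_projections.
  split=> //; move: (congr1 fst y0); rewrite /yy /= z0 linear0.
  by rewrite /= addr0.
- move=> v y0; split.
    case=> w; rewrite e''E => -[<- _]; apply/AK.
    by have := congr1 fst (syy w); rewrite sE.
  move/AK => vA; pose z := (v, 0) + al y0.
  have sv : s (v, 0) = 0 by rewrite sE /= vA.
  have : e' (y0 - be z) = 0.
    by rewrite linearB beE /z linearD alE sv add0r subrr.
  case E : (y0 - be z) => [p1 z1] /ker' [/kerE [p' dp'] z10].
  exists (p', z); rewrite e''E.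
  have -> : yy (p', z) = y0 by rewrite /yy /= dp' -z10 -E subrK.
  by rewrite /= /z /= addrK.
Qed.

End Projective.

Section CoherentRegular.
Variable S : comNzRingType.
Hypotheses (cohS : coherent S) (regS : regular_ring S).

Lemma sum_mulmx n (c g : 'I_n -> S) :
  \sum_i c i * g i = ((\row_i c i) *m (\col_i g i) : 'M_1) 0 0.
Proof. by rewrite mxE; apply: eq_bigr => i _; rewrite !mxE. Qed.

Lemma mx11_eq0 (M : 'M[S]_1) : M = 0 <-> M 0 0 = 0.
Proof.
split=> [->|M0]; first by rewrite mxE.
by apply/matrixP => i j; rewrite !ord1 M0 mxE.
Qed.

Lemma in_idealP n (g : 'cV[S]_n) r : in_ideal (fun i => g i 0) r <-> exists u, u *m g = r%:M.
Proof.
split=> [[c ->]|[u ug]].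
  exists (\row_i c i); rewrite sum_mulmx.
  have -> : (\col_i g i 0) = g by apply/colP => i; rewrite mxE.
  by apply/matrixP => i j; rewrite !ord1 [RHS]mxE eqxx.
exists (u 0); move/matrixP/(_ 0 0): ug; rewrite !mxE eqxx mulr1n => <-.
by apply: eq_bigr.
Qed.

(* The presentation of the ideal may use other generators [h]; the columns of
   relations of [h] are transported to [g] along g = D h and h = C g. *)
Lemma coherent_syz_col n (g : 'cV[S]_n) : exists k (B : 'M_(k, n)), syzygies g B.
Proof.
have [l [h0 [k [rel0 [Ih relh]]]]] := cohS (fun i => g i 0).
pose h : 'cV_l := \col_i h0 i; pose rel := \matrix_(i, j) rel0 i j.
have hE : h0 = (fun i => h i 0) by apply/funext => i; rewrite mxE.
have Igh r : (exists u, u *m g = r%:M) <-> (exists u, u *m h = r%:M).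
  by rewrite -!in_idealP Ih hE.
have syzh : syzygies h rel.
  move=> u; rewrite mx11_eq0.
  have -> : (u *m h) 0 0 = \sum_i u 0 i * h0 i.
    by rewrite mxE; apply: eq_bigr => i _; rewrite !mxE.
  rewrite relh; split=> [[d dE]|[w ->]].
    exists (\row_i d i); apply/rowP => i; rewrite dE !mxE.
    by apply: eq_bigr => j _; rewrite !mxE.
  by exists (w 0) => i; rewrite mxE; apply: eq_bigr => j _; rewrite !mxE.
have unit_row m (a : 'cV[S]_m) i : delta_mx 0 i *m a = (a i 0)%:M.
  by rewrite -rowE; apply/matrixP => i' j; rewrite !ord1 !mxE eqxx.
have /choice [D0 DE] : forall i, exists u, u *m h = (g i 0)%:M.
  by move=> i; apply/Igh; exists (delta_mx 0 i); apply: unit_row.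
have /choice [C0 CE] : forall i, exists u, u *m g = (h i 0)%:M.
  by move=> i; apply/Igh; exists (delta_mx 0 i); apply: unit_row.
pose D := \matrix_i D0 i; pose C := \matrix_i C0 i.
have Dh : D *m h = g.
  by apply/row_matrixP => i; rewrite row_mul rowK DE rowE unit_row.
have Cg : C *m g = h.
  by apply/row_matrixP => i; rewrite row_mul rowK CE rowE unit_row.
exists (n + k)%N, (col_mx (1%:M - D *m C) (rel *m C)) => u; split; last first.
  case=> w ->; rewrite -mulmxA mul_col_mx mulmxBl mul1mx -!mulmxA Cg Dh subrr.
  by rewrite (syzygies_mul0 syzh) col_mx0 mulmx0.
move=> ug; have /syzh [w uD] : (u *m D) *m h = 0 by rewrite -mulmxA Dh.
exists (row_mx u w); rewrite mul_row_col mulmxBr mulmx1 !mulmxA uD.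
by rewrite subrK.
Qed.

(** Column by column: the syzygies of the first column form im [B], and those among them that kill
    the other columns come from the syzygies [C] of [B *m rsubmx A]. *)
Lemma coherent_syz m n (A : 'M[S]_(m, n)) : exists k (B : 'M_(k, m)), syzygies A B.
Proof.
elim: n m A => [|n IH] m A.
  exists m, 1%:M => u; split=> _; first by exists u; rewrite mulmx1.
  by apply/matrixP => i [].
move: A; rewrite -[n.+1]/(1 + n)%N => A.
have [k [B AB]] := coherent_syz_col (lsubmx A).
have [l [C BC]] := IH _ (B *m rsubmx A).
exists l, (C *m B) => u; rewrite -{1}[A]hsubmxK mul_mx_row; split.
  rewrite -[0]row_mx0 => /eq_row_mx [/AB [w ->]].
  by rewrite -mulmxA => /BC [w' ->]; exists w'; rewrite mulmxA.
case=> w ->; rewrite -row_mx0; congr row_mx.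
  by rewrite -!mulmxA (syzygies_mul0 AB) !mulmx0.
by rewrite -!mulmxA (syzygies_mul0 BC) !mulmx0.
Qed.

Lemma coherent_regular_fin_res : fin_res_ideals S.
Proof.
move=> n g; have [P [e [fpde imE]]] := finite_proj_dim_fpd (regS (fun i => g i 0)).
have [e' e'E] : exists e' : {linear (P * 'rV[S]_0)%type -> ('rV[S]_1 * 'rV[S]_0)%type},
    e' =1 fun y => ((e y.1)%:M, 0).
  apply: linear_ex => c u v; congr (_, _); last by rewrite /= scaler0 addr0.
  by rewrite linearP raddfD /= -scale_scalar_mx.
apply: (fpd_fin_res coherent_syz fpde (e' := e')).
- exact: projective_rV.
- exact: projective_rV.
- move=> p z; rewrite e'E /=; split.
    move/(congr1 fst)/mx11_eq0; rewrite mxE eqxx mulr1n => ep; split=> //.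
    by apply/rowP => -[].
  by case=> -> _; rewrite raddf0.
- move=> v q; split.
    case=> y; rewrite e'E => -[<- _].
    have /in_idealP [u ug] : in_ideal (fun i => g i 0) (e y.1) by apply/imE; exists y.1.
    by exists u.
  case=> u ->.
  have /imE [p ep] : in_ideal (fun i => g i 0) ((u *m g) 0 0).
    by apply/in_idealP; exists u; rewrite [LHS]mx11_scalar.
  exists (p, 0); rewrite e'E /= ep -mx11_scalar; congr (_, _).
  by apply/rowP => -[].
Qed.

End CoherentRegular.

(** * Finite extensions and parameter sequences *)

Section Integrality.
Variables (R S : comNzRingType) (f : {rmorphism R -> S}).

(** Determinant trick: [F] is the characteristic polynomial of a matrix of multiplication by [c] on
    the generators; its value at [c] kills every generator, hence 1. *)
Lemma fin_gen_integral : fin_gen_module f -> forall c : S,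
  exists2 F : {poly R}, F \is monic & (map_poly f F).[c] = 0.
Proof.
case=> n [g genS] c.
have /choice [a aE] : forall i, exists a : 'I_n -> R, c * g i = \sum_j f (a j) * g j.
  by move=> i; apply: genS.
pose M : 'M[R]_n := \matrix_(i, j) a i j; pose N := c%:M - map_mx f M.
exists (char_poly M); first exact: char_poly_monic.
rewrite map_char_poly.
have -> : (char_poly (map_mx f M)).[c] = \det N.
  rewrite -/(horner_eval c _) -det_map_mx; congr (\det _).
  apply/matrixP => i j; rewrite /char_poly_mx !mxE rmorphB rmorphMn /=.
  by rewrite !horner_evalE hornerX hornerC.
have Ng : N *m (\col_i g i) = 0.
  apply/colP => i; rewrite mulmxBl mul_scalar_mx !mxE aE.
  by apply/eqP; rewrite subr_eq0; apply/eqP/eq_bigr => j _; rewrite !mxE.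
have detg i : \det N * g i = 0.
  have /colP/(_ i) : (\det N)%:M *m (\col_i g i) = 0.
    by rewrite -mul_adj_mx -mulmxA Ng mulmx0.
  by rewrite mul_scalar_mx !mxE.
have [b b1] := genS 1.
rewrite -[LHS]mulr1 b1 mulr_sumr big1 // => i _.
by rewrite mulrCA detg mulr0.
Qed.

(** The monic equation of [c] is read from its constant term up: as [c] is in [q], the constant
    coefficient lies in [p] and so maps into [q']; what remains is [c] times a shorter expression,
    and [q'] is prime. The leading coefficient 1 stops the descent. *)
Lemma incomparability (p : R -> Prop) (q q' : S -> Prop) (c : S) :
  fin_gen_module f -> prime_ideal p -> prime_ideal q -> prime_ideal q' ->
  (forall a, q (f a) -> p a) -> (forall a, p a -> q' (f a)) ->
  (forall a, q' a -> q a) -> q c -> q' c.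
Proof.
move=> fg prp prq prq' qp pq' q'q qc; have [F Fmon Fc] := fin_gen_integral fg c.
have [p0 p1 _ _ _] := prp; have [q0 _ qD qM _] := prq; have [q'0 _ q'D q'M q'P] := prq'.
have : q' (map_poly f F).[c] by rewrite Fc.
have : exists i, ~ p F`_i by exists (size F).-1; rewrite -lead_coefE (monicP Fmon).
elim/poly_ind: F {Fmon Fc} => [|G a IH] [i npi].
  by case: npi; rewrite coef0.
rewrite rmorphD rmorphM /= map_polyX map_polyC hornerMXaddC => q'F.
have [pa|npa] := pselect (p a); last first.
  case: npa; apply: qp; rewrite -[f a](addKr ((map_poly f G).[c] * c)).
  by apply: (qD); [rewrite -mulNr; apply: (qM)|apply: q'q].
have : q' ((map_poly f G).[c] * c).
  rewrite -[_ * c](addrK (f a)); apply: (q'D) => //.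
  by rewrite -mulN1r; apply: (q'M); apply: pq'.
case/q'P => // q'G; apply: IH => //.
case: i npi => [|i]; rewrite coefD coefMX coefC /= ?add0r ?addr0 // => npi.
by exists i.
Qed.

End Integrality.

Section ParameterSequences.
Variable R : comNzRingType.
Implicit Types (x y : R) (p : R -> Prop).

(** A nonzero [r] is not nilpotent, so some prime [p] avoids its powers; [x * r = 0] puts [x] in
    [p], while [r], being zero in [R_x], kills all of [H^1]. *)
Lemma parameter_seq1_regular x :
  (forall (r : R) n, r ^+ n = 0 -> r = 0) -> parameter_seq [:: x] ->
  forall r, x * r = 0 -> r = 0.
Proof.
move=> red [//|[_ _ loc]] r xr; apply: contrapT => r0.
have [|||p [prp _ pr]] := @prime_disjoint _ (fun a => a = 0) (fun a => exists n, a = r ^+ n).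
- split=> // [a b -> ->|a b ->]; by rewrite ?addr0 ?mulr0.
- split; first by exists 0%N; rewrite expr0.
  by move=> _ _ [m ->] [n ->]; exists (m + n)%N; rewrite exprD.
- by move=> _ -> [n /esym /red].
have npr : ~ p r by move=> /pr; apply; exists 1%N.
have px : p x by have [p0 _ _ _ pP] := prp; case: (pP x r) => //; rewrite xr.
have [|a [k nz]] := loc p prp; first by move=> b; rewrite inE => /eqP ->.
apply: (nz _ npr); exists 0%N, 1%N, (fun=> 0).
rewrite big_seq1 big1 => [|i _]; last by rewrite mul0r.
by rewrite mul0r subr0 expr0 expr1 mulr1 mulrA xr mul0r.
Qed.

(* If a y = x c, then a^k kills every class b / (x y)^k of H^2, since
   a^k b / (x y)^k = b c^k / y^(2k) comes from R_y. *)
Lemma parameter_seq2_colon x y p : parameter_seq [:: x; y] -> prime_ideal p ->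
  p x -> p y ->
  (forall a c, a * y = x * c -> p a) /\ (forall a c, a * x = y * c -> p a).
Proof.
case=> [//|[_ _ loc]] prp px py.
have [|b [k nz]] := loc p prp; first by move=> z; rewrite !inE => /orP [] /eqP ->.
have nzk a : cech_top_zero [:: x; y] (a ^+ k * b) k -> p a.
  by move=> z; apply: contrapT => npa; by apply: (nz _ _ z) => /(prime_exp prp).
split=> a c e; apply: nzk.
  have ek : a ^+ k * y ^+ k = x ^+ k * c ^+ k by rewrite -!exprMn e.
  exists (k + k)%N, 0%N, (fun i => if i == 0%N :> nat then b * c ^+ k else 0).
  rewrite !big_ord_recl big_ord0 big_cons big_seq1 /= expr0 mul1r mul0r !addr0.
  transitivity (b * x ^+ k * x ^+ k * y ^+ k * (a ^+ k * y ^+ k - x ^+ k * c ^+ k)).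
    by rewrite !exprMn !exprD; ring.
  by rewrite ek subrr mulr0.
have ek : a ^+ k * x ^+ k = y ^+ k * c ^+ k by rewrite -!exprMn e.
exists (k + k)%N, 0%N, (fun i => if i == 0%N :> nat then 0 else b * c ^+ k).
rewrite !big_ord_recl big_ord0 big_cons big_seq1 /= expr0 mul1r mul0r add0r !addr0.
transitivity (b * x ^+ k * y ^+ k * y ^+ k * (a ^+ k * x ^+ k - y ^+ k * c ^+ k)).
  by rewrite !exprMn !exprD; ring.
by rewrite ek subrr mulr0.
Qed.

End ParameterSequences.

Section Retract.
Variables (R S : comNzRingType) (f : {rmorphism R -> S}) (rho : S -> R).
Hypotheses (retr : module_retract f rho) (fg : fin_gen_module f).

(** The elements [s] with [rho (s S)] inside [p] form an ideal that contains [f p] and, as [rho]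
    fixes [R], misses the image of the complement of [p]. *)
Lemma retract_prime (p : R -> Prop) : prime_ideal p ->
  exists q, [/\ prime_ideal q, forall s, (forall t, p (rho (s * t))) -> q s
    & forall a, q (f a) <-> p a].
Proof.
move=> prp; have [rhoD rhoM rhof] := retr; have [p0 p1 pD pM pP] := prp.
have rho0 : rho 0 = 0 by rewrite -(rmorph0 f) rhof.
have [|||q [prq nq qW]] := @prime_disjoint S (fun s => forall t, p (rho (s * t)))
    (fun s => exists2 a, ~ p a & s = f a).
- split=> [t|a b na nb t|a b nb t]; first by rewrite mul0r rho0.
    by rewrite mulrDl rhoD; apply: pD.
  by rewrite [a * b]mulrC -mulrA; apply: nb.
- split; first by exists 1; rewrite ?rmorph1.
  move=> _ _ [a na ->] [b nb ->]; exists (a * b); last by rewrite rmorphM.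
  by case/pP.
- by move=> t nt [a npa e]; apply: npa; have := nt 1; rewrite e mulr1 rhof.
exists q; split=> // a; split=> [qa|pa].
  by apply: contrapT => npa; apply: (qW _ qa); exists a.
by apply: nq => t; rewrite rhoM mulrC; apply: pM.
Qed.

Hypotheses (cohS : coherent S) (regS : regular_ring S).

Lemma regular_pair (x y r s : R) :
  (forall p : R -> Prop, prime_ideal p -> p x -> p y ->
    (forall a c, a * y = x * c -> p a) /\ (forall a c, a * x = y * c -> p a)) ->
  y * r = x * s -> exists c, r = x * c.
Proof.
move=> param yr; apply: contrapT => nxr; have [rhoD rhoM rhof] := retr.
have res := coherent_regular_fin_res cohS regS.
pose I a := exists c, a * r = x * c.
have idI : ideal I.
  split=> [|a b [c ac] [d bd]|a b [c bc]]; first by exists 0; rewrite mul0r mulr0.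
    by exists (c + d); rewrite mulrDl ac bd mulrDr.
  by exists (a * c); rewrite -mulrA bc mulrCA.
have [||p [prp [Ip minp] _]] := minimal_prime (W := fun a => a = 1) idI.
- by split=> // a b -> ->; rewrite mulr1.
- by move=> a [c e] a1; apply: nxr; exists c; rewrite -e a1 mul1r.
have px : p x by apply: Ip; exists r.
have py : p y by apply: Ip; exists s.
have [colx coly] := param p prp px py.
have [q [prq nq qfp]] := retract_prime prp.
have [q0 q1 qD qM qP] := prq.
(* Multiplying by [u] and applying [rho] turns a relation in [S] into one in [R], where the colon
   condition applies. *)
have Vq a b : a * f y = f x * b -> q a.
  move=> e; apply: nq => u; apply: (colx _ (rho (b * u))).
  by rewrite mulrC -!rhoM; congr rho; rewrite mulrA [f y * a]mulrC e mulrA.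
have V'q a b : a * f x = f y * b -> q a.
  move=> e; apply: nq => u; apply: (coly _ (rho (b * u))).
  by rewrite mulrC -!rhoM; congr rho; rewrite mulrA [f x * a]mulrC e mulrA.
pose J a := exists t, a * f r = f x * t.
have Jq a : J a -> q a.
  case=> t e; apply: nq => u; apply: Ip; exists (rho (t * u)).
  by rewrite mulrC -!rhoM; congr rho; rewrite mulrA [f r * a]mulrC e mulrA.
have idJ : ideal J.
  split=> [|a b [c ac] [d bd]|a b [c bc]]; first by exists 0; rewrite mul0r mulr0.
    by exists (c + d); rewrite mulrDl ac bd mulrDr.
  by exists (a * c); rewrite -mulrA bc mulrCA.
(* Otherwise a prime [q'] over [J] inside [q] misses [c]; as [p] is minimal over [I], [q'] still
   contains [f p], and incomparability puts [c] in [q']. *)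
have minq : minimal_over q J.
  split=> // c qc; apply: contrapT => nex; have [n1 nM] := prime_compl prq.
  have [||q' [prq' Jq' q'W]] :=
      @prime_disjoint _ J (fun a => exists k t, ~ q t /\ a = t * c ^+ k) idJ.
  - split; first by exists 0%N, 1; rewrite mulr1.
    move=> _ _ [k [t [nt ->]]] [l [u [nu ->]]]; exists (k + l)%N, (t * u).
    by split; [apply: nM|rewrite exprD; ring].
  - by move=> a Ja [k [t [nt e]]]; apply: nex; exists k, t; rewrite -e.
  have q'q a : q' a -> q a.
    move=> q'a; apply: contrapT => na; apply: (q'W _ q'a).
    by exists 0%N, a; rewrite mulr1.
  apply: (q'W c); last by exists 1%N, 1; rewrite mul1r.
  apply: (incomparability fg prp prq prq' _ _ q'q qc) => a; first by move/qfp.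
  case/minp => k [t [npt [u e]]]; have [_ _ _ _ q'P] := prq'.
  have : q' (f t * f a ^+ k).
    by apply: Jq'; exists (f u); rewrite -rmorphXn -!rmorphM e.
  by case/q'P => [/q'q/qfp //|]; apply: prime_exp.
pose A : 'cV[S]_2 := \col_i (if i == 0 then f x else f y).
pose u : 'rV[S]_2 := \row_i (if i == 0 then f y else - f x).
have [d [E [nd EA kE]]] :=
  fin_res_split_at prq minq (regular_or_zero_at res (f x) prq) (res _ A).
have uE : u *m E = 0.
  by apply: kE; apply/mx11_eq0; rewrite !mxE !big_ord_recl big_ord0 !mxE /=; ring.
(* With entries [E00], [E01], [E10] of [E], [E A = d A] gives [(d - E00) x = E01 y], and killing the
   Koszul syzygy [u] gives [E00 y = E10 x]: both [d - E00] and [E00] lie in [q], hence so does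
   [d]. *)
move/matrixP/(_ 0 0): EA; rewrite !mxE !big_ord_recl big_ord0 !mxE /= addr0 => e1.
move/matrixP/(_ 0 0): uE; rewrite !mxE !big_ord_recl big_ord0 !mxE /= addr0 => e2.
apply: nd; rewrite -[d](subrK (E 0 0)); apply: (qD).
  by apply: (V'q _ (E 0 (lift ord0 ord0))); rewrite mulrBl -e1; ring.
apply: (Vq _ (E (lift ord0 ord0) 0)); apply/eqP.
by rewrite -subr_eq0; apply/eqP; rewrite -[RHS]e2; ring.
Qed.

End Retract.

(** * Sequences of length at most two *)

Lemma in_ideal_seq1 (R : comNzRingType) (x r : R) :
  in_ideal_seq [:: x] r <-> exists c, r = x * c.
Proof.
split=> [[c ->]|[c ->]].
  by exists (c ord0); rewrite big_ord_recl big_ord0 addr0 mulrC.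
by exists (fun=> c); rewrite big_ord_recl big_ord0 addr0 mulrC.
Qed.

Lemma in_ideal_seq0 (R : comNzRingType) (r : R) : in_ideal_seq [::] r <-> r = 0.
Proof.
split=> [[c ->]|->]; first by rewrite big_ord0.
by exists (fun=> 0); rewrite big_ord0.
Qed.

Theorem theorem4p14 (R S : comNzRingType) (f : {rmorphism R -> S}) (rho : S -> R)
    (x : seq R) :
  injective f ->
  module_retract f rho ->
  fin_gen_module f ->
  coherent S ->
  regular_ring S ->
  strong_parameter_seq x ->
  (size x <= 2)%N ->
  regular_seq x.
Proof.
move=> injf retr fg cohS regS strong size2.
(* [R] embeds in the reduced ring [S]. *)
have redR (r : R) n : r ^+ n = 0 -> r = 0.
  move=> rn; apply: injf; rewrite rmorph0.
  apply: (reduced_regular (coherent_regular_fin_res cohS regS) (n := n)).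
  by rewrite -rmorphXn rn rmorph0.
split; last first.
  case: x strong size2 => [|a l] strong _.
    by move/in_ideal_seq0/eqP; rewrite oner_eq0.
  by have [] := strong (size (a :: l)) (leqnn _); rewrite take_size => // -[].
case: x strong size2 => [|a [|b [|//]]] strong _ i //= il r.
  case: i il => // _; rewrite /= !in_ideal_seq0.
  exact: parameter_seq1_regular redR (strong 1%N isT) r.
case: i il => [|[|//]] _ /=.
  rewrite !in_ideal_seq0.
  exact: parameter_seq1_regular redR (strong 1%N isT) r.
rewrite !in_ideal_seq1 => -[s e].
apply: (regular_pair retr fg cohS regS _ e) => p.
exact: parameter_seq2_colon (strong 2%N isT).
Qed.
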